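(* For a finite simple graph $G$ put $f(G)=e(G)+3-S_2(G)$, where $S_2(G)=q_1(G)+q_2(G)$ is the sum of the two largest signless Laplacian eigenvalues of $G$. Then $\lim_{n\to\infty} f(S_n^+)=0$. Moreover, $S_n^+$ is the only firefly graph for which the inequality $S_2(G)\le e(G)+3$ is asymptotically tight, in the following sense: if $(G_m)_{m\ge 1}$ is a sequence of firefly graphs with $|V(G_m)|\to\infty$ and $f(G_m)\to 0$ as $m\to\infty$, then for all sufficiently large $m$ the graph $G_m$ is isomorphic to $S_{n_m}^+$, where $n_m=|V(G_m)|$.
   Context: All graphs are finite and simple. For a graph $G$ on $n$ vertices with $e(G)$ edges, $Q(G)=D+A$ is the signless Laplacian, where $A$ is the adjacency matrix and $D$ the diagonal matrix of vertex degrees; its eigenvalues (with multiplicity) are indexed in non-increasing order $q_1(G)\ge q_2(G)\ge\dots\ge q_n(G)$. For integers $r,s,t\ge 0$, the firefly graph $F_{r,s,t}$ is the graph on $2r+s+2t+1$ vertices consisting of $r$ triangles, $s$ pendant edges and $t$ pendant paths of length $2$, all sharing one common vertex (and otherwise disjoint). A firefly graph is a graph isomorphic to some $F_{r,s,t}$. For $n\ge 3$, $S_n^+$ is the star graph on $n$ vertices plus one edge (joining two leaves); it is isomorphic to $F_{1,n-3,0}$. *)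

(* Defs.v *)
From HB Require Import structures.
From mathcomp Require Import all_boot all_order all_algebra.
From mathcomp Require Import reals polyrcf.

Set Implicit Arguments.
Unset Strict Implicit.
Unset Printing Implicit Defensive.

Import Order.TTheory GRing.Theory Num.Theory.

Local Open Scope ring_scope.

Record sgraph := SGraph {
  svertex :> finType;
  sedge : rel svertex;
  sedge_sym : symmetric sedge;
  sedge_irrefl : irreflexive sedge }.

Definition sg_iso (G H : sgraph) : Prop :=
  exists2 h : G -> H, bijective h & forall x y, sedge (h x) (h y) = sedge x y.

Definition edges (G : sgraph) : {set {set G}} :=
  [set e : {set G} | [exists x, exists y, sedge x y && (e == [set x; y])]].

Definition num_edges (G : sgraph) : nat := #|edges G|.

Definition degree (G : sgraph) (x : G) : nat := #|[set y | sedge x y]|.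

Section Spectrum.
Variable R : realType.

(* Vertices are numbered by [enum_val]; the spectrum does not depend on it. *)
Definition adj_mx (G : sgraph) : 'M[R]_#|G| :=
  \matrix_(i, j) (sedge (enum_val i) (enum_val j))%:R.

Definition deg_mx (G : sgraph) : 'M[R]_#|G| :=
  diag_mx (\row_i (degree (enum_val i))%:R).

Definition signless_laplacian (G : sgraph) : 'M[R]_#|G| :=
  deg_mx G + adj_mx G.

(* The real roots of the characteristic polynomial, repeated according to
   multiplicity and in non-increasing order. For a real symmetric matrix of
   size n these are all the eigenvalues, so the list has n entries. *)
Definition eigenvalues (n : nat) (A : 'M[R]_n) : seq R :=
  let p := char_poly A in
  sort >=%R (flatten [seq nseq (mup x p) x | x <- rootsR p]).

(* [qeig G k] is q_k(G), indexed from 1, for 1 <= k <= #|G|. *)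
Definition qeig (G : sgraph) (k : nat) : R :=
  (eigenvalues (signless_laplacian G))`_k.-1.

Definition S2 (G : sgraph) : R := qeig G 1 + qeig G 2.

Definition fgap (G : sgraph) : R := (num_edges G)%:R + 3 - S2 G.

End Spectrum.

Section Firefly.
Variables r s t : nat.

(* [None] is the common vertex, [(i, _)] on the left are the two other
   vertices of the i-th triangle, the middle summand consists of the pendant
   vertices, and the k-th pendant path is None - (k, false) - (k, true). *)
Definition firefly_vertex : finType :=
  option ('I_r * bool + 'I_s + 'I_t * bool)%type.

Definition firefly_edge : rel firefly_vertex := fun u v =>
  match u, v with
  | None, Some (inl _) | Some (inl _), None => true
  | None, Some (inr (_, b)) | Some (inr (_, b)), None => ~~ b
  | Some (inl (inl (i, b))), Some (inl (inl (j, c))) => (i == j) && (b != c)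
  | Some (inr (i, b)), Some (inr (j, c)) => (i == j) && (b != c)
  | _, _ => false
  end.

Lemma firefly_edge_sym : symmetric firefly_edge.
Proof.
by move=> [[[[i b]|i]|[i b]]|] [[[[j c]|j]|[j c]]|] //=;
  rewrite [i == j]eq_sym [b == c]eq_sym.
Qed.

Lemma firefly_edge_irrefl : irreflexive firefly_edge.
Proof. by move=> [[[[i b]|i]|[i b]]|] //=; rewrite !eqxx. Qed.

Definition firefly_graph : sgraph :=
  SGraph firefly_edge_sym firefly_edge_irrefl.

End Firefly.

Definition firefly (G : sgraph) : Prop :=
  exists r s t : nat, sg_iso G (firefly_graph r s t).

Section StarPlus.
Variable n : nat.

(* Centre 0, leaves 1, ..., n - 1, and the additional edge {1, 2}. This is
   S_n^+ for 3 <= n; for n <= 2 the additional edge is absent. *)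
Definition star_plus_edge : rel 'I_n := fun i j =>
  (i != j) && [|| i == 0%N :> nat, j == 0%N :> nat
                | (i <= 2)%N && (j <= 2)%N].

Lemma star_plus_edge_sym : symmetric star_plus_edge.
Proof.
by move=> i j; rewrite /star_plus_edge eq_sym orbCA [in RHS]andbC
  [(j <= 2)%N && _]andbC andbC.
Qed.

Lemma star_plus_edge_irrefl : irreflexive star_plus_edge.
Proof. by move=> i; rewrite /star_plus_edge eqxx. Qed.

Definition star_plus : sgraph :=
  SGraph star_plus_edge_sym star_plus_edge_irrefl.

End StarPlus.

(* Main.v *)
Require Import Defs.
From HB Require Import structures.
From mathcomp Require Import all_boot all_order all_algebra all_fingroup.
From mathcomp Require Import all_classical all_reals all_analysis.
From mathcomp Require Import polyrcf ring lra zify.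

Set Implicit Arguments.
Unset Strict Implicit.
Unset Printing Implicit Defensive.

Import Order.TTheory GRing.Theory Num.Theory.
Import numFieldNormedType.Exports.

Local Open Scope ring_scope.

(** Write d = 2 r + s + t for the degree of the centre of F_{r,s,t}. Solving the
    eigenvalue equations from the blocks towards the centre and applying
    Cramer's rule, char_poly Q * den = num * C, where C is the principal
    cofactor at the centre and num / den is the secular function
      x - d - 2 r / (x - 3) - s / (x - 1) - t (x - 1) / (x^2 - 3 x + 1).
    An eigenvector vanishing at the centre lives on the blocks, so the roots of C
    are among 1, 3 (if r > 0) and those of x^2 - 3 x + 1 (if t > 0). The secular
    function is increasing to the right of its poles, so at most one eigenvalue
    exceeds 3 (27/10 if r = 0, 1 for a star), and q_1 <= d + 1 + 4 / d. Since
    e = d + r + t, this gives f >= r + t + 2 - q_2 - 4 / d, which stays away from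
    0 unless r = 1 and t = 0. In that case f -> 0, because the secular function
    has a root above d + 1 and one just below 3. *)

(** * Multiplicity and order in the list of eigenvalues *)

Section Eigenvalues.
Variables (R : realType) (n : nat) (A : 'M[R]_n).

Let p_neq0 : char_poly A != 0 := monic_neq0 (char_poly_monic A).

(** [rootsR] lists each real root once, so [x] occurs only in its own block; for a non-root both
    sides are 0. *)
Lemma count_eigenvalues x : count_mem x (eigenvalues A) = mup x (char_poly A).
Proof.
rewrite /eigenvalues /= (seq.permP (permEl (perm_sort _ _))) count_flatten -map_comp.
have memR y : (y \in rootsR (char_poly A)) = root (char_poly A) y.
  by rewrite -(roots_on_rootsR p_neq0) in_itv.
rewrite (eq_map (_ : _ =1 fun y => (if y == x then mup x (char_poly A) else 0)%N)).
  have -> s : sumn [seq (if y == x then mup x (char_poly A) else 0)%N | y <- s]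
      = (count_mem x s * mup x (char_poly A))%N.
    by elim: s => //= y s ->; case: ifP => _; rewrite ?mulSn ?add0n.
  rewrite count_uniq_mem; last exact: uniq_roots.
  have [rx|rx] := boolP (root (char_poly A) x); first by rewrite memR rx mul1n.
  by rewrite memR (negPf rx) (mupNroot rx).
by move=> y /=; rewrite count_nseq /=; case: eqVneq => [->|_]; rewrite ?mul1n.
Qed.

Lemma mem_eigenvalues x : (x \in eigenvalues A) = root (char_poly A) x.
Proof.
by rewrite -has_pred1 has_count count_eigenvalues -XsubC_dvd // dvdp_XsubCl.
Qed.

Lemma eigenvalues_sorted : sorted >=%R (eigenvalues A).
Proof. exact: sort_sorted ge_total _. Qed.

Lemma eigenvalues_ge i x y : (i <= 1)%N -> x \in eigenvalues A ->
  y \in eigenvalues A -> y < x -> (nth x [:: x; y] i) <= (eigenvalues A)`_i.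
Proof.
have := eigenvalues_sorted; case: (eigenvalues A) => // a [|b s].
  by rewrite !inE => _ _ /eqP-> /eqP->; rewrite ltxx.
move=> srt i1; have lt_s z : z \in b :: s -> z <= b.
  rewrite inE => /predU1P[->//|zs]; case/andP: srt => _.
  by move/(order_path_min ge_trans)/allP/(_ _ zs).
have ab : b <= a by case/andP: srt.
rewrite !(in_cons a) => /predU1P[->|/lt_s xb] /predU1P[->|/lt_s yb]; rewrite ?ltxx // => xy;
  case: i i1 => [|[|//]] _ //=.
- exact: le_trans ab.
- exact: ltW (lt_le_trans xy xb).
- exact: le_trans ab.
Qed.

Lemma eigenvalues_le c : 0 <= c -> (forall x, root (char_poly A) x -> x <= c) ->
  (eigenvalues A)`_0 <= c.
Proof.
(* For an empty list the default entry is 0, which [c0] covers. *)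
move=> c0 ub; case def_e: (eigenvalues A) => [|a e] //=.
by apply: ub; rewrite -mem_eigenvalues def_e mem_head.
Qed.

(** If the second entry exceeds [c], so does the first, and the product of their linear factors
    divides the characteristic polynomial: by coprimality if they differ, by multiplicity if they
    agree. *)
Lemma eigenvalues1_le c : 0 <= c ->
  (forall x y, c < x -> c < y ->
     ~~ (('X - x%:P) * ('X - y%:P) %| char_poly A)) ->
  (eigenvalues A)`_1 <= c.
Proof.
move=> c0 ndvd; rewrite leNgt; apply/negP => lt1.
have := eigenvalues_sorted; have cnt := count_eigenvalues; have memE := mem_eigenvalues.
case def_e: (eigenvalues A) lt1 cnt memE => [|a [|b e]] /= lt1 cnt memE;
  try by rewrite ltNge c0 in lt1.
case/andP=> ba _; have ca : c < a by exact: lt_le_trans ba.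
have /negP[] := ndvd _ _ ca lt1.
have [eq_ab|ne_ab] := eqVneq a b.
  by rewrite -eq_ab -expr2 -mup_geq // -cnt /= eq_ab !eqxx.
rewrite Gauss_dvdp ?dvdp_XsubCl -?memE ?inE ?eqxx ?orbT //.
by rewrite coprimep_XsubC root_XsubC eq_sym.
Qed.

End Eigenvalues.

(** * Invariance of spectrum and edge count under isomorphism *)

Lemma det_reindex (S : comNzRingType) (T : finType) n m (f : 'I_n -> T)
    (g : 'I_m -> T) (F : T -> T -> S) : bijective f -> bijective g ->
  \det (\matrix_(i, j) F (f i) (f j)) = \det (\matrix_(i, j) F (g i) (g j)).
Proof.
move=> bij_f bij_g.
have eq_nm : n = m.
  by rewrite -(card_ord n) -(card_ord m) (bij_eq_card bij_f) (bij_eq_card bij_g).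
case: _ / eq_nm => {m} in g bij_g *; case: bij_g => g' gK g'K.
have inj_h : injective (g' \o f).
  exact: inj_comp (can_inj g'K) (bij_inj bij_f).
(* The same permutation acts on rows and columns, so its sign cancels. *)
have -> : \matrix_(i, j) F (f i) (f j) =
    row_perm (perm inj_h) (col_perm (perm inj_h) (\matrix_(i, j) F (g i) (g j))).
  by apply/matrixP=> i j; rewrite !mxE !permE /= !g'K.
rewrite row_permE col_permE !det_mulmx !det_perm odd_permV.
by rewrite mulrC -mulrA -signr_addb addbb mulr1.
Qed.

Lemma degree_iso (G H : sgraph) (h : G -> H) u : bijective h ->
  (forall x y, sedge (h x) (h y) = sedge x y) -> degree (h u) = degree u.
Proof.
case=> h' hK h'K hE; rewrite /degree -(card_imset _ (can_inj hK)).
congr #|pred_of_set _|; apply/finset.setP=> v; rewrite !inE -[v]h'K hE.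
by rewrite mem_imset ?inE //; exact: can_inj hK.
Qed.

Definition lap_entry (R : pzRingType) (G : sgraph) (u v : G) : R :=
  (degree u)%:R *+ (u == v) + (sedge u v)%:R.

Lemma signless_laplacianE (R : realType) (G : sgraph) :
  signless_laplacian R G =
  \matrix_(i, j) lap_entry R (enum_val i) (enum_val j).
Proof.
by apply/matrixP=> i j; rewrite !mxE /lap_entry (inj_eq enum_val_inj).
Qed.

Lemma char_poly_iso (R : realType) (G H : sgraph) : sg_iso G H ->
  char_poly (signless_laplacian R G) = char_poly (signless_laplacian R H).
Proof.
case=> h bij_h hE; pose F (u v : H) : {poly R} :=
  'X *+ (u == v) - (lap_entry R u v)%:P.
have -> : char_poly (signless_laplacian R G) =
    \det (\matrix_(i < #|G|, j < #|G|) F (h (enum_val i)) (h (enum_val j))).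
  congr (\det _); rewrite signless_laplacianE; apply/matrixP=> i j.
  rewrite !mxE /F /lap_entry hE (degree_iso _ bij_h hE) !(inj_eq (bij_inj bij_h)).
  by rewrite (inj_eq enum_val_inj).
have -> : char_poly (signless_laplacian R H) =
    \det (\matrix_(i < #|H|, j < #|H|) F (enum_val i) (enum_val j)).
  congr (\det _); rewrite signless_laplacianE; apply/matrixP=> i j.
  by rewrite !mxE /F (inj_eq enum_val_inj).
apply: (det_reindex (f := fun i : 'I_#|G| => h (enum_val i))); last exact: enum_val_bij.
exact: bij_comp bij_h (enum_val_bij _).
Qed.

(** Ordered adjacent pairs are grouped by first entry and by underlying edge; an edge comes from
    exactly two of them. *)
Lemma handshake (G : sgraph) : (num_edges G).*2 = (\sum_(u : G) degree u)%N.
Proof.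
have -> : (\sum_(u : G) degree u = \sum_(p : G * G | sedge p.1 p.2) 1)%N.
  rewrite -(pair_big_dep xpredT (@sedge G) (fun _ _ => 1%N)) /=; apply: eq_bigr => u _.
  by rewrite sum1_card; apply: eq_card => v; rewrite !inE.
rewrite (partition_big (fun p : G * G => [set p.1; p.2]) (mem (edges G))) /=; last first.
  case=> u v /= uv; rewrite inE; apply/existsP; exists u; apply/existsP; exists v.
  by rewrite uv eqxx.
rewrite -muln2 /num_edges -sum_nat_const; apply: eq_bigr => e.
rewrite inE => /existsP[u /existsP[v /andP[uv /eqP->]]].
have ne_uv : u != v by apply: contraTneq uv => ->; rewrite sedge_irrefl.
rewrite sum1_card; transitivity #|[set (u, v); (v, u)]|.
  by rewrite cards2 xpair_eqE (negPf ne_uv).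
apply: eq_card => -[a b]; rewrite !inE /= !xpair_eqE.
apply/orP/andP => [[]/andP[/eqP-> /eqP->]|[ab /eqP/finset.setP eq_e]].
- by rewrite uv.
- by rewrite sedge_sym uv finset.setUC.
have ne_ab : a != b by apply: contraTneq ab => ->; rewrite sedge_irrefl.
have := eq_e a; have := eq_e b; rewrite !inE !eqxx ?orbT => /esym bP /esym aP.
case/orP: aP ne_ab bP => /eqP-> /negPf; rewrite eq_sym => ->;
  rewrite ?orbF eqxx /= => ->; auto.
Qed.

Lemma num_edges_iso (G H : sgraph) : sg_iso G H -> num_edges G = num_edges H.
Proof.
case=> h bij_h hE; apply: double_inj; rewrite !handshake (reindex h) /=; last exact: onW_bij.
by apply: eq_bigr => u _; rewrite (degree_iso _ bij_h hE).
Qed.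

Lemma fgap_iso (R : realType) (G H : sgraph) : sg_iso G H -> fgap R G = fgap R H.
Proof.
move=> GH; rewrite /fgap /S2 /qeig /eigenvalues.
by rewrite (char_poly_iso R GH) (num_edges_iso GH).
Qed.

Lemma sg_iso_trans (G H K : sgraph) : sg_iso G H -> sg_iso H K -> sg_iso G K.
Proof.
case=> h bij_h hE [k bij_k kE]; exists (k \o h); first exact: bij_comp.
by move=> x y; rewrite /= kE hE.
Qed.

(** * The signless Laplacian on vertex functions, and Cramer's rule at a vertex *)

Definition lap (V : nmodType) (G : sgraph) (x : G -> V) (u : G) : V :=
  \sum_(v | sedge u v) (x u + x v).

(** The diagonal degree spreads over the incident edges, one copy of [x u] for each. In the form
    [lap] the operator also acts on functions into the natural numbers. *)
Lemma lap_entryE (S : pzRingType) (G : sgraph) (x : G -> S) u :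
  \sum_v lap_entry S u v * x v = lap x u.
Proof.
rewrite /lap big_split /= sumr_const [in RHS]big_mkcond /=.
under eq_bigr do rewrite mulrDl; rewrite big_split /= (bigD1 u) //= big1 => [|v]; last first.
  by rewrite eq_sym => /negPf->; rewrite mulr0n mul0r.
rewrite eqxx mulr1n addr0 mulr_natl; congr (_ *+ _ + _).
  by apply: eq_card => v; rewrite inE.
by apply: eq_bigr => v _; case: ifP => _; rewrite ?mul1r ?mul0r.
Qed.

Lemma sum_enum_val (V : nmodType) (G : finType) (F : G -> V) :
  \sum_(j < #|G|) F (enum_val j) = \sum_v F v.
Proof. by rewrite [RHS](reindex (@enum_val G G)) //; exact: onW_bij (enum_val_bij _). Qed.

Section Cramer.
Variables (R : realType) (G : sgraph) (c : G).

Let Q := signless_laplacian R G.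

Definition vertex_cofactor : {poly R} :=
  cofactor (char_poly_mx Q) (enum_rank c) (enum_rank c).

(** The hypothesis says that X - Q maps [V] to [H] times the unit vector at [c]; multiplying by the
    adjugate and reading entry [c] gives the identity. *)
Lemma char_poly_cofactor (V : G -> {poly R}) (H : {poly R}) :
    (forall u, 'X * V u - lap V u = H *+ (u == c)) ->
  char_poly Q * V c = H * vertex_cofactor.
Proof.
move=> VP; pose v : 'cV_#|G| := \col_i V (enum_val i).
have Mv : char_poly_mx Q *m v = H *: delta_mx (enum_rank c) 0.
  apply/colP=> i; rewrite mulmxBl mul_scalar_mx !mxE.
  have -> : \sum_j map_mx polyC Q i j * v j 0 = lap V (enum_val i).
    rewrite -lap_entryE -[RHS]sum_enum_val; apply: eq_bigr => j _.
    rewrite /Q signless_laplacianE !mxE /lap_entry polyCD !polyCMn.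
    by rewrite polyC1.
  by rewrite VP -(can2_eq enum_valK enum_rankK) eqxx andbT mulr_natr.
have := congr1 (fun M : 'cV_ _ => (\adj (char_poly_mx Q) *m M) (enum_rank c) 0) Mv.
rewrite mulmxA mul_adj_mx mul_scalar_mx -scalemxAr !mxE enum_rankK => ->.
congr (_ * _); rewrite (bigD1 (enum_rank c)) //= big1 => [|j /negPf nj]; rewrite !mxE ?eqxx.
  by rewrite mulr1 addr0.
by rewrite nj mulr0.
Qed.

(** At a root the minor of X - Q without row and column [c] is singular. A left kernel vector,
    extended by 0 at [c], satisfies the equations away from [c] because Q is symmetric. *)
Lemma vertex_cofactor_root q : root vertex_cofactor q ->
  exists Y : G -> R, [/\ Y c = 0, exists u, Y u != 0
    & forall u, u != c -> lap Y u = q * Y u].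
Proof.
rewrite /root /vertex_cofactor /cofactor -signr_odd addnn odd_double mul1r.
rewrite -[_.[q]]/(horner_eval q _) -det_map_mx => /det0P[y y0 yM].
pose Y u : R := oapp (y 0) 0 (unlift (enum_rank c) (enum_rank u)).
exists Y; split=> [||u uc].
- by rewrite /Y unlift_none.
- have /rV0Pn[j yj] := y0; exists (enum_val (lift (enum_rank c) j)).
  by rewrite /Y enum_valK liftK.
have [j def_u] : exists j, u = enum_val (lift (enum_rank c) j).
  have := unliftP (enum_rank c) (enum_rank u); case=> [j /(congr1 enum_val)|/enum_rank_inj uc'].
    by rewrite enum_rankK; exists j.
  by rewrite uc' eqxx in uc.
have := congr1 (fun M : 'rV_ _ => M 0 j) yM; rewrite !mxE.
under eq_bigr => k _.
  rewrite !mxE /= /horner_eval hornerD hornerN hornerMn hornerX hornerC mulrBr.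
over.
rewrite sumrB => /eqP; rewrite subr_eq0 (bigD1 j) //= big1 => [|k /negPf nk]; last first.
  by rewrite (inj_eq lift_inj) nk mulr0n mulr0.
rewrite eqxx mulr1n addr0 => /eqP eqj.
have -> : Y u = y 0 j by rewrite /Y def_u enum_valK liftK.
rewrite mulrC eqj -lap_entryE -[LHS]sum_enum_val (bigD1_ord (enum_rank c)) //=.
rewrite {1}/Y enum_valK unlift_none mulr0 add0r; apply: eq_bigr => k _.
rewrite /Y enum_valK liftK /= mulrC def_u /lap_entry (inj_eq enum_val_inj) sedge_sym.
by congr (_ * (_ + _)); rewrite eq_sym; case: eqP => // ->.
Qed.

End Cramer.

(** * Block decomposition of a firefly graph *)

Notation tri i b := (Some (inl (inl (i, b)))).
Notation pend j := (Some (inl (inr j))).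
Notation path2 k b := (Some (inr (k, b))).

Section FireflySums.
Variables (V : nmodType) (r s t : nat).
Implicit Type x : firefly_graph r s t -> V.

Lemma big_firefly (F : firefly_vertex r s t -> V) :
  \sum_v F v = F None + (\sum_(i < r) (F (tri i false) + F (tri i true)) +
    \sum_(j < s) F (pend j) +
    \sum_(k < t) (F (path2 k false) + F (path2 k true))).
Proof.
have sum_bool (I : finType) (f : I * bool -> V) :
    \sum_p f p = \sum_i (f (i, false) + f (i, true)).
  rewrite (eq_bigr (fun p => f (p.1, p.2))) => [|[]//].
  rewrite -(pair_bigA _ (fun i b => f (i, b))) /=.
  by apply: eq_bigr => i _; rewrite big_bool addrC.
rewrite (bigD1 None) //=; congr (_ + _).
rewrite (reindex_omap (Some) id) => [|[]//]; rewrite (eq_bigl xpredT) => [|v]; last first.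
  by rewrite eqxx.
by rewrite !big_sumType !sum_bool.
Qed.

Lemma lap_tri x i b :
  lap x (tri i b) = x (tri i b) + x None + (x (tri i b) + x (tri i (~~ b))).
Proof.
rewrite /lap (bigD1 None) //= (bigD1 (tri i (~~ b))) /=; last by rewrite eqxx; case: b.
rewrite big1 ?addr0 // => -[[[[j c]|j]|[j c]]|] //= /andP[/andP[/andP[/eqP <- bc] _] /eqP[]].
by case: b c bc => [] [].
Qed.

Lemma lap_pend x j : lap x (pend j) = x (pend j) + x None.
Proof.
by rewrite /lap (bigD1 None) //= big1 ?addr0 // => -[[[[i c]|i]|[i c]]|].
Qed.

Lemma lap_path_near x k : lap x (path2 k false) =
  x (path2 k false) + x None + (x (path2 k false) + x (path2 k true)).
Proof.
rewrite /lap (bigD1 None) //= (bigD1 (path2 k true)) /=; last by rewrite eqxx.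
by rewrite big1 ?addr0 // => -[[[[j c]|j]|[j []]]|] //=
  /andP[/andP[/andP[/eqP <- bc] _] /eqP[]].
Qed.

Lemma lap_path_far x k :
  lap x (path2 k true) = x (path2 k true) + x (path2 k false).
Proof.
rewrite /lap (bigD1 (path2 k false)) /=; last by rewrite eqxx.
by rewrite big1 ?addr0 // => -[[[[j c]|j]|[j []]]|] //= /andP[/andP[/eqP <- bc] /eqP[]].
Qed.

Lemma lap_center x : lap x None =
  \sum_(i < r) (x None + x (tri i false) + (x None + x (tri i true))) +
  \sum_(j < s) (x None + x (pend j)) +
  \sum_(k < t) (x None + x (path2 k false)).
Proof.
rewrite /lap big_mkcond big_firefly /= add0r.
by congr (_ + _); apply: eq_bigr => k _; rewrite addr0.
Qed.

End FireflySums.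

Lemma card_firefly r s t : #|firefly_graph r s t| = (2 * r + s + 2 * t).+1.
Proof.
by rewrite card_option !card_sum !card_prod card_bool !card_ord mulnC [(t * 2)%N]mulnC.
Qed.

(** On the constant 1, [lap] is twice the degree, so its total is four times the number of edges;
    the block formulas evaluate this total. *)
Lemma num_edges_firefly r s t : num_edges (firefly_graph r s t) = (3 * r + s + 2 * t)%N.
Proof.
have lap1 (u : firefly_graph r s t) : lap (fun _ => 1%N) u = (degree u * 2)%N.
  by rewrite /lap sum_nat_const; congr (_ * _)%N; apply: eq_card => v; rewrite inE.
have : (\sum_(u : firefly_graph r s t) lap (fun _ => 1) u =
    (num_edges (firefly_graph r s t)).*2 * 2)%N.
  by rewrite handshake big_distrl /=; apply: eq_bigr => u _; exact: lap1.
rewrite big_firefly lap_center.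
rewrite (eq_bigr _ (fun i _ => congr2 +%R (lap_tri _ i false) (lap_tri _ i true))).
rewrite (eq_bigr _ (fun j _ => lap_pend _ j)).
rewrite (eq_bigr _ (fun k _ => congr2 +%R (lap_path_near _ k) (lap_path_far _ k))).
rewrite !sum_nat_const !card_ord; lia.
Qed.

(** * The characteristic polynomial of a firefly graph *)

Section FireflyCharPoly.
Variables (R : realType) (r s t : nat).

Let F := firefly_graph r s t.
Let p := char_poly (signless_laplacian R F).

(* To the common denominator of the secular function, the triangles contribute
   the factor X - 3 and the paths the factor X^2 - 3 X + 1; [Dr] and [Dt] stand
   for these factors, which may be replaced by 1 when there is no such block. *)
Variables Dr Dt : {poly R}.
Hypothesis DrE : (0 < r)%N -> Dr = 'X - 3.
Hypothesis DtE : (0 < t)%N -> Dt = 'X^2 - 3 * 'X + 1.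

Definition firefly_den := Dr * ('X - 1) * Dt.

Definition firefly_num := ('X - (2 * r + s + t)%:R) * firefly_den
  - (2 * r)%:R * (('X - 1) * Dt) - s%:R * (Dr * Dt) - t%:R * (Dr * ('X - 1) ^+ 2).

Lemma char_poly_firefly :
  p * firefly_den = firefly_num * vertex_cofactor R (None : F).
Proof.
(* Normalised to 1 at the centre, the block equations give 1 / (x - 3) on triangles, 1 / (x - 1) on
   pendant vertices, (x - 1) / (x^2 - 3 x + 1) and 1 / (x^2 - 3 x + 1) along a path; [V] is this
   times the common denominator. *)
pose V (v : F) := match v with
  | None => firefly_den
  | tri _ _ => ('X - 1) * Dt
  | pend _ => Dr * Dt
  | path2 _ false => Dr * ('X - 1) ^+ 2
  | path2 _ true => Dr * ('X - 1)
  end.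
apply: (@char_poly_cofactor R F None V firefly_num) => -[[[[i b]|j]|[k b]]|] /=.
- by rewrite lap_tri /= /firefly_den DrE ?(leq_ltn_trans _ (ltn_ord i)) //; ring.
- by rewrite lap_pend /= /firefly_den; ring.
- have t_gt0 : (0 < t)%N := leq_ltn_trans (leq0n k) (ltn_ord k).
  by case: b; rewrite ?lap_path_near ?lap_path_far /= /firefly_den ?DtE //; ring.
rewrite lap_center /= !sumr_const !card_ord mulr1n -![(_ + _) *+ _]mulr_natl.
rewrite /firefly_num (natrD _ (2 * r + s)) (natrD _ (2 * r)) natrM /firefly_den.
move: (r%:R : {poly R}) (s%:R : {poly R}) (t%:R : {poly R}) => r' s' t'; ring.
Qed.

(** With value 0 at the centre the equations decouple into blocks with characteristic polynomials (q
    - 1)(q - 3), q - 1 and q^2 - 3 q + 1, so every block vanishes. *)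
Lemma firefly_cofactor_neq0 q : q != 1 -> ((0 < r)%N -> q != 3) ->
  ((0 < t)%N -> q ^+ 2 - 3 * q + 1 != 0) -> ~~ root (vertex_cofactor R (None : F)) q.
Proof.
move=> q1 q3 qw; apply/negP => /vertex_cofactor_root[Y [Y0 [u Yu]]] YE.
have tri0 i b : Y (tri i b) = 0.
  have := YE (tri i (~~ b)) isT; have := YE (tri i b) isT; rewrite !lap_tri negbK Y0.
  have {}q3 := q3 (leq_ltn_trans (leq0n _) (ltn_ord i)).
  move: (Y (tri i b)) (Y (tri i (~~ b))) => a b' e1.
  have -> : b' = (q - 2) * a by lra.
  move=> e2; have : (q - 1) * (q - 3) * a = 0 by lra.
  by move/eqP; rewrite !mulf_eq0 !subr_eq0 (negPf q1) (negPf q3) => /eqP.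
have pend0 j : Y (pend j) = 0.
  have := YE (pend j) isT; rewrite lap_pend Y0; move: (Y _) => a e1.
  have /eqP : (q - 1) * a = 0 by lra.
  by rewrite mulf_eq0 subr_eq0 (negPf q1) => /eqP.
have path0 k b : Y (path2 k b) = 0.
  have := YE (path2 k false) isT; have := YE (path2 k true) isT.
  rewrite lap_path_near lap_path_far Y0.
  have {}qw := qw (leq_ltn_trans (leq0n _) (ltn_ord k)) => e1.
  have def_u : Y (path2 k false) = (q - 1) * Y (path2 k true) by lra.
  rewrite def_u => e2; have /eqP : (q ^+ 2 - 3 * q + 1) * Y (path2 k true) = 0 by lra.
  by rewrite mulf_eq0 (negPf qw) => /eqP v0; case: b; rewrite ?def_u v0 ?mulr0.
by case: u Yu => [[[[i b]|j]|[k b]]|]; rewrite ?tri0 ?pend0 ?path0 ?Y0 eqxx.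
Qed.

End FireflyCharPoly.

(** * Bounds on q_1, q_2 and the gap *)

Section FireflySpectrum.
Variables (R : realType) (r s t : nat).

Let F := firefly_graph r s t.
Let p := char_poly (signless_laplacian R F).
Let d : R := (2 * r + s + t)%:R.

Lemma firefly_numE (Dr Dt : {poly R}) x : (firefly_num r s t Dr Dt).[x] =
  (x - d) * (Dr.[x] * (x - 1) * Dt.[x]) - (2 * r)%:R * ((x - 1) * Dt.[x])
  - s%:R * (Dr.[x] * Dt.[x]) - t%:R * (Dr.[x] * (x - 1) ^+ 2).
Proof.
by rewrite /firefly_num /firefly_den -!polyC_natr !hornerE.
Qed.

(* The secular function num / den is increasing above [c], and the product
   num(X) den(x) - num(x) den(X) = (X - x) K exhibits this also at a double
   root. *)
Lemma firefly_two_roots (Dr Dt : {poly R}) c :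
    ((0 < r)%N -> Dr = 'X - 3) -> ((0 < t)%N -> Dt = 'X^2 - 3 * 'X + 1) ->
    (forall y, c < y -> [/\ 1 < y, 0 < Dr.[y] & 0 < Dt.[y]]) ->
  forall x y, c < x -> c < y -> ~~ (('X - x%:P) * ('X - y%:P) %| p).
Proof.
move=> DrE DtE pos x y cx cy; apply/negP => dvd_p.
have nroot z : c < z -> ~~ root (vertex_cofactor R (None : F)) z.
  move=> /pos[z1 Drz Dtz]; apply: firefly_cofactor_neq0; first by rewrite gt_eqF.
  - by move=> /DrE eDr; move: Drz; rewrite eDr -polyC_natr !hornerE subr_gt0 => /gt_eqF->.
  - by move=> /DtE eDt; move: Dtz; rewrite eDt -polyC_natr !hornerE => /gt_eqF->.
(* The cofactor has no root above [c], hence is coprime to both linear factors. *)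
have : ('X - x%:P) * ('X - y%:P) %| firefly_num r s t Dr Dt.
  rewrite -(@Gauss_dvdpl _ _ (vertex_cofactor R (None : F))).
    by rewrite -(char_poly_firefly s DrE DtE) dvdp_mulr.
  by rewrite coprimepMl !(coprimep_sym ('X - _)) !coprimep_XsubC !nroot.
have [x1 Drx Dtx] := pos x cx; have [y1 Dry Dty] := pos y cy.
case/dvdpP=> T def_num; set a := Dr.[x] in Drx; set b := Dt.[x] in Dtx.
(* [K] sums the divided differences of the secular terms, cleared of denominators. The path term
   uses u (v^2 - v - 1) - v (u^2 - u - 1) = (v - u)(u v + 1) with u = X - 1, v = x - 1. *)
pose K := (a * (x - 1) * b)%:P * firefly_den Dr Dt
  + (2 * r)%:R * (('X - 1) * (x - 1)%:P * Dt * b%:P)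
  + s%:R * (Dr * a%:P * Dt * b%:P)
  + t%:R * (Dr * a%:P * (('X - 1) * (x - 1)%:P) * (('X - 1) * (x - 1)%:P + 1)).
have num0 : (firefly_num r s t Dr Dt).[x] = 0.
  by rewrite def_num !hornerE /= subrr mulr0 mul0r.
have KE : (a * (x - 1) * b)%:P * firefly_num r s t Dr Dt = ('X - x%:P) * K.
  have <- : (a * (x - 1) * b)%:P * firefly_num r s t Dr Dt
      - ((firefly_num r s t Dr Dt).[x])%:P * firefly_den Dr Dt
      = (a * (x - 1) * b)%:P * firefly_num r s t Dr Dt.
    by rewrite num0 mul0r subr0.
  have r_alt : (2 * r)%:R = 0 :> {poly R} \/ Dr = 'X - 3 /\ a%:P = x%:P - 3.
    have [->|/DrE e] := posnP r; [by left | right; split=> //].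
    by rewrite /a e -polyC_natr !hornerE polyCB.
  have t_alt : t%:R = 0 :> {poly R} \/
      Dt = 'X^2 - 3 * 'X + 1 /\ b%:P = x%:P ^+ 2 - 3 * x%:P + 1.
    have [->|/DtE e] := posnP t; [by left | right; split=> //].
    by rewrite /b e -!polyC_natr !hornerE /= !(polyCD, polyCN, polyCM, rmorphXn).
  rewrite firefly_numE -/a -/b /K /firefly_num /firefly_den /d.
  rewrite !(polyCD, polyCN, polyCM, rmorphXn, polyC_natr) /=.
  move: (2 * r + s + t)%N (s%:R : {poly R}) => d' s'.
  move: ((2 * r)%:R : {poly R}) (t%:R : {poly R}) r_alt t_alt => r' t'.
  move: (d'%:R : {poly R}) => d''.
  by case=> [->|[-> ->]] [->|[-> ->]]; ring.
(* The second factor makes [K] vanish at [y], even for y = x, while all its summands there are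
   nonnegative and the first is positive. *)
have : (a * (x - 1) * b) * T.[y] * (y - y) = K.[y].
  have Xx : 'X - x%:P != 0 by rewrite polyXsubC_eq0.
  have -> : K = (a * (x - 1) * b)%:P * T * ('X - y%:P).
    by apply: (mulfI Xx); rewrite -KE def_num; ring.
  by rewrite !hornerE.
apply/eqP; rewrite subrr mulr0 lt_eqF // /K /firefly_den -!polyC_natr !hornerE.
have x10 : 0 < x - 1 by rewrite subr_gt0.
have y10 : 0 < y - 1 by rewrite subr_gt0.
have xy0 : 0 < (y - 1) * (x - 1) + 1 by rewrite addr_gt0 // mulr_gt0.
rewrite /= !ltr_wpDr ?mulr_gt0 //; do ?[apply: mulr_ge0]; by rewrite ?ler0n // ltW.
Qed.

Lemma firefly_q1_le : 10 <= d -> qeig R F 1 <= d + 1 + 4 / d.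
Proof.
move=> d10; have d_gt0 : 0 < d by lra.
have fd : 0 <= 4 / d by rewrite divr_ge0 // ltW.
rewrite /qeig; apply: eigenvalues_le => [|x rx]; first lra.
rewrite leNgt; apply/negP => lt_x.
have w_gt0 : 0 < x ^+ 2 - 3 * x + 1 by nra.
have nroot : ~~ root (vertex_cofactor R (None : F)) x.
  by apply: firefly_cofactor_neq0 => [|_|_]; rewrite gt_eqF //; lra.
have /(congr1 (horner^~ x)) :=
  char_poly_firefly s (fun=> erefl ('X - 3 : {poly R}))
    (fun=> erefl ('X^2 - 3 * 'X + 1 : {poly R})) (r := r) (t := t).
move: (vertex_cofactor _ _) nroot => C nroot.
rewrite !hornerM (rootP rx) mul0r => /esym/eqP.
rewrite mulf_eq0 orbC -rootE (negPf nroot) /=.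
rewrite firefly_numE -!polyC_natr !hornerE /= natrM => /eqP.
have : (2 * r%:R + s%:R + t%:R) = d.
  by rewrite /d (natrD _ (2 * r + s)) (natrD _ (2 * r)) natrM.
have := ler0n R r; have := ler0n R s; have := ler0n R t.
move: (r%:R : R) (s%:R : R) (t%:R : R) => r' s' t' t0 s0 r0 dE.
(* Each secular fraction is at most its numerator coefficient over x - 3, so the contradiction needs
   only (x - d)(x - 3) = (1 + e)(d - 2 + e) > d, which e d > 4 and d >= 10 ensure. *)
have [e def_e] : exists e, x = d + 1 + e by exists (x - d - 1); ring.
have ed : 4 < e * d by rewrite -ltr_pdivrMr //; lra.
have e_gt0 : 0 < e by nra.
set w := x ^+ 2 - 3 * x + 1 in w_gt0 *.
have s_le : s' * ((x - 3) * w) <= s' * ((x - 1) * w) by rewrite ler_wpM2l // ler_wpM2r; lra.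
have t_le : t' * ((x - 3) * (x - 1) ^+ 2) <= t' * ((x - 1) * w).
  by rewrite ler_wpM2l // expr2 mulrA mulrC ler_wpM2l /w; lra.
have lt_d : d < (x - d) * (x - 3) by rewrite def_e; nra.
have : d * ((x - 1) * w) < (x - d) * (x - 3) * ((x - 1) * w).
  by rewrite ltr_pM2r // mulr_gt0; lra.
rewrite -dE; lra.
Qed.

Lemma firefly_q2_le3 : qeig R F 2 <= 3.
Proof.
apply: eigenvalues1_le => //.
apply: (@firefly_two_roots ('X - 3) ('X^2 - 3 * 'X + 1)) => // y y3.
by rewrite -!polyC_natr !hornerE /=; split; nra.
Qed.

(* The largest root of X^2 - 3 X + 1 is (3 + sqrt 5) / 2 < 27 / 10. *)
Lemma firefly0_q2_le : r = 0%N -> qeig R F 2 <= 27 / 10.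
Proof.
move=> r0; apply: eigenvalues1_le; first lra.
apply: (@firefly_two_roots 1 ('X^2 - 3 * 'X + 1)) => //; first by rewrite r0.
by move=> y yc; rewrite -!polyC_natr !hornerE /=; split; nra.
Qed.

Lemma star_q2_le : r = 0%N -> t = 0%N -> qeig R F 2 <= 1.
Proof.
move=> r0 t0; apply: eigenvalues1_le => //.
apply: (@firefly_two_roots 1 1) => //; rewrite ?r0 ?t0 //.
by move=> y yc; rewrite !hornerE /=; split.
Qed.

Lemma fgap_firefly_ge : 10 <= d ->
  r%:R + t%:R + 2 - 4 / d - qeig R F 2 <= fgap R F.
Proof.
move=> /firefly_q1_le; rewrite /fgap /S2 num_edges_firefly /d.
rewrite (natrD _ (2 * r + s)) (natrD _ (2 * r)) (natrD _ (3 * r + s)) (natrD _ (3 * r)) !natrM.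
lra.
Qed.

End FireflySpectrum.

(** * The gap away from and along the graphs S_n^+ *)

Lemma fgap_firefly_gt (R : realType) (r s t : nat) :
  (40 <= 2 * r + s + t)%N -> ~~ ((r == 1%N) && (t == 0%N)) ->
  1 / 10 < fgap R (firefly_graph r s t).
Proof.
move=> d40 nS.
have d40R : (40 : R) <= (2 * r + s + t)%:R by rewrite ler_nat.
have := @fgap_firefly_ge R r s t; have := @firefly_q2_le3 R r s t.
have := @firefly0_q2_le R r s t; have := @star_q2_le R r s t.
have fd : 4 / (2 * r + s + t)%:R <= 1 / 10 :> R.
  by rewrite ler_pdivrMr; lra.
(* The resulting lower bounds are 9/10 for stars, 1/5 for r = 0 < t, and 9/10 in the two remaining
   cases. *)
have [r0|r0] := posnP r; have [t0|t0] := posnP t.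
- by move=> /(_ r0 t0) q2 _ _; have := ler0n R r; have := ler0n R t; lra.
- move=> _ /(_ r0) q2 _; have : (1 : R) <= t%:R by rewrite ler1n.
  by have := ler0n R r; lra.
- move=> _ _ q2; have : (2 : R) <= r%:R by rewrite ler_nat; lia.
  by have := ler0n R t; lra.
move=> _ _ q2; have : (1 : R) <= t%:R by rewrite ler1n.
by have : (1 : R) <= r%:R; [rewrite ler1n | lra].
Qed.


Lemma fgap_star_plus_le (R : realType) (s : nat) (eps : R) :
  0 < eps -> eps < 1 -> 4 <= s%:R * eps -> fgap R (firefly_graph 1 s 0) <= eps.
Proof.
move=> eps0 eps1 s_eps; pose F := firefly_graph 1 s 0.
have s4 : 4 < s%:R :> R by nra.
pose c : {poly R} := firefly_num 1 s 0 ('X - 3) 1.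
have cE x : c.[x] =
    (x - (2 + s%:R)) * ((x - 3) * (x - 1)) - 2 * (x - 1) - s%:R * (x - 3).
  rewrite firefly_numE (natrD _ (2 * 1 + s)) (natrD _ (2 * 1)) muln1.
  by rewrite -!polyC_natr !hornerE /=; ring.
have root_p x : root c x -> x != 3 -> x != 1 ->
    x \in eigenvalues (signless_laplacian R F).
  move=> /rootP cx x3 x1; rewrite mem_eigenvalues.
  have := congr1 (horner^~ x) (char_poly_firefly s (fun=> erefl ('X - 3 : {poly R}))
    (r := 1) (t := 0) (Dt := 1) (fun t0 => False_ind _ (notF t0))).
  move: (vertex_cofactor _ _) => C; rewrite !hornerM -/c cx mul0r -!polyC_natr !hornerE /=.
  move/eqP; rewrite !mulf_eq0 !subr_eq0 (negPf x3) (negPf x1) /= orbF.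
  by rewrite -rootE oner_eq0 !orbF.
(* The numerator is -4 at 3, and positive at 3 - eps since s eps >= 4. *)
have [b] : {b | b \in `]3 - eps, 3[ & root c b}.
  apply: poly_ivtoo; first lra.
  rewrite pmulr_rlt0 !cE; last nra.
  by nra.
rewrite in_itv /= => /andP[b_gt b_lt] cb.
(* The numerator is -4 at s + 3 and s^2 + 5 s at s + 4. As e + 3 = s + 6, the two roots leave a gap
   of at most eps. *)
have [a] : {a | a \in `]s%:R + 3, s%:R + 4[ & root c a}.
  apply: poly_ivtoo; first lra.
  rewrite nmulr_rlt0 !cE; last nra.
  by nra.
rewrite in_itv /= => /andP[a_gt a_lt] ca.
have ea : a \in eigenvalues (signless_laplacian R F).
  by apply: root_p; rewrite // gt_eqF //; lra.
have eb : b \in eigenvalues (signless_laplacian R F).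
  by apply: root_p => //; [rewrite lt_eqF | rewrite gt_eqF]; lra.
have lt_ba : b < a by lra.
have := eigenvalues_ge (isT : (0 <= 1)%N) ea eb lt_ba.
have := eigenvalues_ge (isT : (1 <= 1)%N) ea eb lt_ba.
rewrite /fgap /S2 num_edges_firefly /= /qeig.
rewrite (natrD _ (3 * 1 + s)) (natrD _ (3 * 1)) -/F /=; lra.
Qed.

Lemma sg_iso_star_plus s : sg_iso (firefly_graph 1 s 0) (star_plus s.+3).
Proof.
pose h (v : firefly_graph 1 s 0) : star_plus s.+3 := match v with
  | None => inord 0
  | tri _ b => inord b.+1
  | pend j => inord (val j).+3
  | path2 _ _ => inord 0
  end.
have hE v : h v = (match v with
  | None => 0 | tri _ b => b.+1 | pend j => (val j).+3 | path2 _ _ => 0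
  end)%N :> nat.
  by case: v => [[[[i b]|j]|[k b]]|] /=; rewrite inordK //; [case: b | have := ltn_ord j; lia].
exists h.
  apply: inj_card_bij; last by rewrite card_firefly card_ord; lia.
  move=> u v /(congr1 val); rewrite /= !hE.
  case: u v => [[[[i b]|j]|[[]//]]|] [[[[i' b']|j']|[[]//]]|] //=.
  - by rewrite !ord1 => -[]; case: b b' => [] [].
  - by case: b.
  - by case: b'.
  - by move=> [/val_inj ->].
move=> u v; rewrite /= /star_plus_edge -(inj_eq val_inj) /= !hE.
case: u v => [[[[i b]|j]|[[]//]]|] [[[[i' b']|j']|[[]//]]|] //=.
- by rewrite !ord1; case: b b' => [] [].
- by case: b.
- by case: b'.
by rewrite andbF.
Qed.

Local Open Scope classical_set_scope.

Theorem mainTheorem1 (R : realType) :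
  (fgap R (star_plus n) @[n --> \oo] --> (0 : R)) /\
  (forall G : nat -> sgraph,
     (forall m : nat, firefly (G m)) ->
     (#|G m| @[m --> \oo] --> \oo) ->
     (fgap R (G m) @[m --> \oo] --> (0 : R)) ->
     \forall m \near \oo, sg_iso (G m) (star_plus #|G m|)).
Proof.
split.
  apply/cvgrPdist_le => e e_gt0; pose eps := Num.min e (1 / 2).
  have eps0 : 0 < eps by rewrite lt_min e_gt0 /=; lra.
  have eps1 : eps < 1 by rewrite gt_min; apply/orP; right; lra.
  have eps_e : eps <= e by rewrite ge_min lexx.
  have [N N_eps] : exists N : nat, 4 / eps <= N%:R.
    exists (Num.truncn (4 / eps)).+1.
    by rewrite ltW // truncnS_gt.
  near=> n.
  have [s def_n] : exists s, n = s.+3.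
    by exists (n - 3)%N; have : (3 <= n)%N by [near: n; exact: nbhs_infty_ge]; lia.
  have Ns : (N + 10 <= s)%N.
    by have : (N + 13 <= n)%N by [near: n; exact: nbhs_infty_ge]; lia.
  rewrite def_n -(fgap_iso R (sg_iso_star_plus s)) sub0r normrN.
  have s_eps : 4 <= s%:R * eps.
    by rewrite -ler_pdivrMr // (le_trans N_eps) // ler_nat; lia.
  have le_eps := fgap_star_plus_le eps0 eps1 s_eps.
  rewrite ler_norml (le_trans le_eps eps_e) andbT.
  have s10 : (10 <= s)%N by lia.
  (* For r = 1, t = 0 and q_2 <= 3 the lower bound is -4 / (s + 2), which is at least -eps. *)
  have := @fgap_firefly_ge R 1 s 0; have := @firefly_q2_le3 R 1 s 0.
  rewrite (natrD _ (2 * 1 + s)) (natrD _ (2 * 1)).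
  have s10R : (10 : R) <= s%:R by rewrite ler_nat.
  move=> q2 /(_ ltac:(lra)).
  have : 4 / (2%:R + s%:R + 0%:R) <= eps by rewrite ler_pdivrMr; [nra | lra].
  by rewrite /= ; lra.
move=> G Gff /cvgnyPge Gn /cvgrPdist_lt/(_ (1 / 10))fG.
have {}fG := fG ltac:(lra).
near=> m.
have [r [s [t iso_m]]] := Gff m.
(* There are at most 2 d + 1 vertices, so 100 of them force d >= 40. *)
have card_m : (100 <= #|G m|)%N by near: m; exact: Gn.
have small : `|0 - fgap R (G m)| < 1 / 10 by near: m.
have cardE : #|G m| = (2 * r + s + 2 * t).+1.
  by case: iso_m => h bij_h _; rewrite (bij_eq_card bij_h) card_firefly.
have [/andP[/eqP r1 /eqP t0]|nS] := boolP ((r == 1%N) && (t == 0%N)).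
  rewrite {}r1 {}t0 in iso_m cardE; have -> : #|G m| = s.+3 by lia.
  exact: sg_iso_trans iso_m (sg_iso_star_plus s).
have := @fgap_firefly_gt R r s t _ nS; rewrite -(fgap_iso R iso_m).
move: small; rewrite sub0r normrN ltr_norml => /andP[_ small] /(_ ltac:(lia)); lra.
Unshelve. all: end_near.
Qed.
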